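(* Let $K$ be a semi-symmetric curvature tensor on a Lorentzian vector space $(V,\langle\,,\rangle)$ of dimension at least $3$. Then all eigenvalues of its Ricci operator $\mathrm{Ric}$ are real. Denote by $\alpha_1,\dots,\alpha_r$ the nonzero (distinct) eigenvalues of $\mathrm{Ric}$ and by $V_1,\dots,V_r$ the corresponding eigenspaces. Then: 1. $V$ splits orthogonally as $V=V_0\oplus V_1\oplus\dots\oplus V_r$, where $V_0=\ker(\mathrm{Ric}^2)$; 2. for all $u,v\in V$ and $i=0,\dots,r$, $K(u,v)(V_i)\subset V_i$; 3. for all $i,j\in\{0,\dots,r\}$ with $i\neq j$, $K(V_i,V_j)=0$; 4. for all $i=1,\dots,r$, $\dim V_i\geq 2$.
   Context: A Lorentzian vector space is a finite-dimensional real vector space with a nondegenerate inner product of signature $(1,n-1)$; $\mathrm{so}(V)$ is the Lie algebra of its skew-symmetric endomorphisms. A curvature tensor on $V$ is a bilinear map $K:V\times V\to\mathrm{so}(V)$ with $K(u,v)=-K(v,u)$ and $K(u,v)w+K(v,w)u+K(w,u)v=0$. Its Ricci curvature is $\mathrm{r}(u,v)=\mathrm{tr}(a\mapsto K(u,a)v)$ and its Ricci operator is defined by $\langle\mathrm{Ric}(u),v\rangle=\mathrm{r}(u,v)$. $K$ is semi-symmetric if $[K(u,v),K(a,b)]=K(K(u,v)a,b)+K(a,K(u,v)b)$ for all $u,v,a,b\in V$. *)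

(* Defs.v *)
From HB Require Import structures.
From mathcomp Require Import all_boot all_order all_algebra.
From mathcomp Require Import sesquilinear polyrcf complex reals.

Set Implicit Arguments.
Unset Strict Implicit.
Unset Printing Implicit Defensive.

Import Order.TTheory GRing.Theory Num.Theory.
Import passmx.
Local Open Scope ring_scope.

Section LinearAlgebra.
Variables (R : realType) (V : vectType R).
Implicit Types (f : 'End(V)) (a : R).

Definition lfun_mx f : 'M[R]_(\dim {:V}) :=
  mxof (vbasis {:V}) (vbasis {:V}) f.

Definition lfun_trace f : R := \tr (lfun_mx f).

(* z is an eigenvalue of the complex-linear extension of f. *)
Definition complex_eigenvalue f (z : R[i]) : bool :=
  eigenvalue (map_mx (real_complex R) (lfun_mx f)) z.

Definition enumerates_nonzero_eigenvalues f r (alpha : r.-tuple R) : Prop :=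
  uniq alpha /\ forall a, (a \in alpha) = (a != 0) && leigenvalue f a.

(* V_0, V_1, ..., V_r: entries of alpha are shifted by one to make room for
   V_0 at index ord0. *)
Definition ker2_eigenspace f r (alpha : r.-tuple R) (i : 'I_r.+1) :
    {vspace V} :=
  if unlift ord0 i is Some j then leigenspace f (tnth alpha j)
  else lker (f \o f)%VF.

Lemma enumeration_exists f :
  exists r (alpha : r.-tuple R), enumerates_nonzero_eigenvalues f alpha.
Proof.
pose s := [seq a <- rootsR (char_poly (lfun_mx f)) | a != 0].
exists (size s), (in_tuple s); split; first exact/filter_uniq/uniq_roots.
move=> a; rewrite mem_filter; congr (_ && _).
rewrite /leigenvalue (leigenspaceE (vbasisP {:V})) vsof_eq0 ?vbasisP//.
rewrite -/(eigenvalue _ a) eigenvalue_root_char.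
have p0 : char_poly (lfun_mx f) != 0 by rewrite monic_neq0 ?char_poly_monic.
have /(_ a) := roots_on_rootsR p0.
by rewrite in_itv.
Qed.

Fact lfun_trace_linear : linear (lfun_trace : 'End(V) -> R^o).
Proof. by move=> a f h; rewrite /lfun_trace /lfun_mx !linearP. Qed.

End LinearAlgebra.

Section Lorentzian.
Variables (R : realType) (V : vectType R).
Implicit Types (g : {symmetric V}) (K : {bilinear V -> V -> 'End(V)}).

(* Signature (p, q) counts the p minus signs first, so that (1, n - 1) is
   (-, +, ..., +). *)
Definition has_signature g (p q : nat) : Prop :=
  exists e : (p + q).-tuple V, basis_of {:V} e /\
    forall i j : 'I_(p + q), g (tnth e i) (tnth e j) =
      if i == j then (if (i < p)%N then -1 else 1) else 0.

Definition lorentzian g : Prop :=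
  nondegenerate g /\ has_signature g 1 (\dim {:V}).-1.

Definition in_so g (f : 'End(V)) : Prop :=
  forall x y, g (f x) y = - g x (f y).

Definition curvature_tensor g K : Prop :=
  [/\ forall u v, in_so g (K u v),
      forall u v, K u v = - K v u
    & forall u v w, K u v w + K v w u + K w u v = 0].

Definition ricci K (u v : V) : R := lfun_trace (linfun (fun a => K u a v)).

Definition ricci_operator g K (Ric : 'End(V)) : Prop :=
  forall u v, g (Ric u) v = ricci K u v.

Definition semi_symmetric K : Prop :=
  forall u v a b,
    (K u v \o K a b)%VF - (K a b \o K u v)%VF = K (K u v a) b + K a (K u v b).

Lemma ricci_operator_exists_unique g K :
  nondegenerate g -> exists! Ric, ricci_operator g K Ric.
Proof.
move=> /eqP g_nd.
have linfun_lin (U W : vectType R) (h : U -> W) : linear h -> linfun h =1 h.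
  move=> h_lin.
  pose F : {linear U -> W} := HB.pack h (GRing.isLinear.Build _ _ _ _ h h_lin).
  exact: (lfunE F).
have g_inj x y : (forall v, g x v = g y v) -> x = y.
  move=> exy; apply/eqP; rewrite -subr_eq0 -memv0 -g_nd.
  by apply/mem_orthovP => v _; rewrite linearBl /= exy subrr.
have lK u v : linear (fun a => K u a v).
  by move=> a x y; rewrite linearPr add_lfunE scale_lfunE.
have ricciDl a u u' v :
    ricci K (a *: u + u') v = a * ricci K u v + ricci K u' v.
  rewrite /ricci -[a * _]/(a *: (_ : R^o)) -lfun_trace_linear.
  congr lfun_trace; apply/lfunP => x.
  rewrite add_lfunE scale_lfunE !(linfun_lin _ _ _ (lK _ _)).
  by rewrite linearPl add_lfunE scale_lfunE.
have ricciDr a u v v' :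
    ricci K u (a *: v + v') = a * ricci K u v + ricci K u v'.
  rewrite /ricci -[a * _]/(a *: (_ : R^o)) -lfun_trace_linear.
  congr lfun_trace; apply/lfunP => x.
  rewrite add_lfunE scale_lfunE !(linfun_lin _ _ _ (lK _ _)).
  by rewrite linearP.
pose n := \dim {:V}; pose e := vbasis {:V}.
have T_lin : linear (fun x : V => \row_(j < n) g x e`_j).
  by move=> a x y; apply/rowP => j; rewrite !mxE linearPl.
have S_lin : linear (fun x : V => \row_(j < n) ricci K x e`_j).
  by move=> a x y; apply/rowP => j; rewrite !mxE ricciDl.
set T := linfun (fun x : V => \row_(j < n) g x e`_j).
set S := linfun (fun x : V => \row_(j < n) ricci K x e`_j).
have ext (h : V -> R) : (forall a x y, h (a *: x + y) = a * h x + h y) ->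
    forall k : V -> R, (forall a x y, k (a *: x + y) = a * k x + k y) ->
    (forall j : 'I_n, h e`_j = k e`_j) -> h =1 k.
  move=> hL k kL hk v.
  have z (l : V -> R) : (forall a x y, l (a *: x + y) = a * l x + l y) ->
      l 0 = 0.
    move=> lL; have := lL (-1) 0 0.
    by rewrite scaler0 addr0 mulN1r addNr.
  rewrite (coord_vbasis (memvf v)).
  elim/big_rec: _ => [|j x _ IH]; first by rewrite !z.
  by rewrite hL kL hk IH.
have T_inj : lker T == 0%VS.
  rewrite -subv0; apply/subvP => x; rewrite memv_ker memv0 => /eqP Tx0.
  apply/eqP/g_inj => v; rewrite linear0l.
  apply: (ext (g x) _ (fun=> 0)).
  - by move=> a y w; rewrite linearPr.
  - by move=> a y w; rewrite mulr0 addr0.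
  - by move=> j; move/rowP: Tx0 => /(_ j); rewrite (linfun_lin _ _ _ T_lin) !mxE.
have T_onto y : exists x, T x = y.
  have: y \in limg T.
    suff -> : limg T = fullv by rewrite memvf.
    apply/eqP; rewrite eqEdim subvf /= (limg_dim_eq _) ?(eqP T_inj) ?capv0//.
    by rewrite !dimvf /= /dim /= mul1n -/n /n dimvf.
  by case/memv_imgP => x _ ->; exists x.
pose Ric := (T^-1 \o S)%VF.
have RicP : ricci_operator g K Ric.
  move=> u; apply: (ext (g (Ric u)) _ (ricci K u)).
  - by move=> a y w; rewrite linearPr.
  - by move=> a y w; rewrite ricciDr.
  move=> j; have : T (Ric u) = S u.
    rewrite /Ric comp_lfunE; have [x <-] := T_onto (S u).
    by rewrite lker0_lfunK.
  by move/rowP => /(_ j); rewrite (linfun_lin _ _ _ T_lin)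
    (linfun_lin _ _ _ S_lin) !mxE.
exists Ric; split=> // Ric' Ric'P; apply/lfunP => u.
by apply: g_inj => v; rewrite RicP Ric'P.
Qed.

End Lorentzian.

(* Main.v *)
Require Import Defs.
From HB Require Import structures.
From mathcomp Require Import all_boot all_order all_algebra.
From mathcomp Require Import sesquilinear complex reals.
From mathcomp Require Import ring lra.

(** Ric is self-adjoint and, by semi-symmetry, commutes with every [K u v]. By
    pair symmetry, a vector killed by all [K u v] is killed by Ric. In Lorentzian
    signature a skew endomorphism with totally isotropic image vanishes, so if
    [h] is a polynomial in Ric and [h^2 K = 0], then [h K = 0]. Hence the
    polynomials [p] with [p(Ric) K = 0] form an ideal with a squarefree generator
    [q], and [Ric q(Ric) = 0]. If [Ric] had a non-real eigenvalue [a + ib], the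
    space [ker ((Ric - a)^2 + b^2)] would contain a timelike [t]; skewness puts
    [K u v t] and [(Ric - a) (K u v t)] in the positive definite complement of
    [t], although their squares have opposite signs, so [K u v t = 0] and
    [Ric t = 0], which is absurd. *)

Set Implicit Arguments.
Unset Strict Implicit.
Unset Printing Implicit Defensive.

Import Order.TTheory GRing.Theory Num.Theory passmx.
Local Open Scope ring_scope.

(** * Split polynomials in an endomorphism, and the primary decomposition they give *)

Section ShiftProduct.
Variables (F : fieldType) (V : vectType F) (S : 'End(V)).
Implicit Types (T : 'End(V)) (a : F) (s : seq F) (x y : V).

(* The polynomial with list of roots [s], evaluated at [S] and applied to [x]. *)
Definition shift_prod s x : V := foldr (fun a y => S y - a *: y) x s.

Lemma shift_prod_cat s1 s2 x :
  shift_prod (s1 ++ s2) x = shift_prod s1 (shift_prod s2 x).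
Proof. exact: foldr_cat. Qed.

Lemma shift_prodP s a x y :
  shift_prod s (a *: x + y) = a *: shift_prod s x + shift_prod s y.
Proof.
elim: s => //= b s ->; rewrite linearP scalerDr scalerBr !scalerA (mulrC b).
by rewrite opprD addrACA.
Qed.

HB.instance Definition _ s :=
  GRing.isLinear.Build F V V *:%R (shift_prod s) (shift_prodP s).

Lemma shift_prod0 s : shift_prod s 0 = 0.
Proof. exact: linear0. Qed.

Lemma shift_prod_comm s T x : (forall y, S (T y) = T (S y)) ->
  shift_prod s (T x) = T (shift_prod s x).
Proof.
move=> ST; elim: s => [|a s IH] /=; first by [].
by rewrite IH ST linearB /= [T (a *: _)]linearZ.

Qed.

Lemma shift_prod_catC s1 s2 x :
  shift_prod s1 (shift_prod s2 x) = shift_prod s2 (shift_prod s1 x).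
Proof.
elim: s1 => //= a s ->.
rewrite -(shift_prod_comm s2 _ (fun=> erefl)) -scaleNr addrC -shift_prodP.
by rewrite scaleNr addrC.
Qed.

Lemma perm_shift_prod s1 s2 x :
  perm_eq s1 s2 -> shift_prod s1 x = shift_prod s2 x.
Proof.
move=> s12; pose P s := shift_prod s1 x = shift_prod s x.
apply: (catCA_perm_ind (P := P) _ s12) => // t1 t2 t3; rewrite /P => ->.
by rewrite !shift_prod_cat shift_prod_catC.
Qed.

Lemma mem_leigenspace a x : (x \in leigenspace S a) = (S x == a *: x).
Proof.
by rewrite memv_ker add_lfunE opp_lfunE scale_lfunE id_lfunE subr_eq0.
Qed.

(** Induction on [s]: [S x - a *: x] lies in the sum without the summand for [a]. Since [S - a] maps
    that sum onto itself, there is a preimage [z] in it, and [x - z] falls in the eigenspace of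
    [a]. *)
Lemma shift_prod_ker_decomp s x : uniq s -> 0 \notin s ->
    shift_prod s x \in lker (S \o S) ->
  x \in (lker (S \o S) + \sum_(a <- s) leigenspace S a)%VS.
Proof.
elim: s x => [|a s IH] x /=; first by rewrite big_nil addv0.
rewrite in_cons negb_or eq_sym => /andP[aNs s_uniq] /andP[a0 s0].
have <- : shift_prod s (S x - a *: x) = S (shift_prod s x) - a *: shift_prod s x.
  by rewrite -[LHS]/(shift_prod s (shift_prod [:: a] x)) shift_prod_catC.
move=> /(IH _ s_uniq s0); rewrite big_cons.
have IHa w : w \in (lker (S \o S) + \sum_(b <- s) leigenspace S b)%VS ->
    exists2 z, z \in (lker (S \o S) + \sum_(b <- s) leigenspace S b)%VS &
      S z - a *: z = w.
  move=> /memv_addP[w0 w0K [w' w'E ->{w}]].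
  have: exists2 z, z \in (\sum_(b <- s) leigenspace S b)%VS & S z - a *: z = w'.
    elim: {IH s0 s_uniq} s aNs w' w'E => [|b s IHs] /=.
      rewrite big_nil => _ w'; rewrite memv0 => /eqP ->; exists 0.
        exact: mem0v.
      by rewrite linear0 scaler0 subrr.
    rewrite in_cons negb_or big_cons => /andP[ab aNs] _ /memv_addP[y yb [w' w's ->]].
    have [z zs zw'] := IHs aNs _ w's.
    (* [S - a] acts as the nonzero scalar [b - a] on the eigenspace of [b]. *)
    exists ((b - a)^-1 *: y + z); first by rewrite memv_add// memvZ.
    move: yb; rewrite mem_leigenspace => /eqP yb.
    rewrite linearP /= yb -zw' scalerDr opprD addrACA; congr (_ + _).
    rewrite !scalerA -scalerBl (mulrC a) -mulrBr mulVf ?scale1r//.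
    by rewrite subr_eq0 eq_sym.
  case=> z zs zw'.
  (* On the kernel of [S \o S], the geometric series for the inverse of [S - a] stops after two
     terms. *)
  exists (- (a^-1 *: w0 + a ^- 2 *: S w0) + z).
    rewrite memv_add// memvN memvD// memvZ//.
    move: w0K; rewrite !memv_ker !comp_lfunE => /eqP ->.
    by rewrite linear0.
  move: w0K; rewrite memv_ker comp_lfunE => /eqP w0K.
  have -> : S (- (a^-1 *: w0 + a ^- 2 *: S w0) + z) = S z - a^-1 *: S w0.
    rewrite addrC [LHS]raddfB [in LHS]raddfD /= ![S (_ *: _)]linearZ /=.
    by rewrite w0K scaler0 addr0.
  have -> : a *: (- (a^-1 *: w0 + a ^- 2 *: S w0) + z) =
      - (w0 + a^-1 *: S w0) + a *: z.
    rewrite !(scalerDr, scalerN) !scalerA mulfV// scale1r.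
    by rewrite expr2 invfM mulrA mulfV// mul1r.
  rewrite -zw' opprD opprK addrA (addrC w0) [S z - _ + _]addrA subrK.
  by rewrite addrAC addrC.
move=> /IHa[z zE zx].
suff xz : x - z \in leigenspace S a.
  by rewrite [(leigenspace S a + _)%VS]addvC addvA -[x](subrK z) addrC memv_add.
have Sx : S x = S z - a *: z + a *: x by rewrite zx subrK.
rewrite mem_leigenspace linearB /= scalerBr Sx addrAC (addrAC (S z)).
by rewrite subrr add0r addrC.
Qed.

End ShiftProduct.

(** * Cayley-Hamilton for a characteristic polynomial that splits *)

Lemma Cayley_Hamilton_factors (F : fieldType) n (A : 'M[F]_n) (s : seq F)
    (v : 'rV_n) : char_poly A = \prod_(a <- s) ('X - a%:P) ->
  foldr (fun a w => w *m A - a *: w) v s = 0.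
Proof.
case: n A v => [|n] A v As; first exact: thinmx0.
suff -> : foldr (fun a w => w *m A - a *: w) v s =
    v *m horner_mx A (\prod_(a <- s) ('X - a%:P)).
  by rewrite -As Cayley_Hamilton mulmx0.
elim: s {As} => [|a s /= ->]; first by rewrite big_nil rmorph1 mulmx1.
rewrite big_cons mulrC rmorphM rmorphB /= horner_mx_X horner_mx_C.
by rewrite -[RHS]/(v *m (_ *m (A - _))) mulmxA mulmxBr mul_mx_scalar.
Qed.

Lemma shift_prod_char_poly (R : realType) (V : vectType R) (S : 'End(V))
    (s : seq R) (x : V) :
  char_poly (lfun_mx S) = \prod_(a <- s) ('X - a%:P) -> shift_prod S s x = 0.
Proof.
move=> /Cayley_Hamilton_factors Ss; have eP := vbasisP {:V}.
apply/eqP; rewrite -(rVof_eq0 eP) -(Ss (rVof (vbasis {:V}) x)).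
apply/eqP; elim: s {Ss} => //= a s IH.
by rewrite linearB linearZ /= (rVof_app (vbasis {:V}) eP) IH.
Qed.

(** * Symmetric forms, with their self-adjoint and skew endomorphisms *)

Section SymmetricForms.
Variables (R : realType) (V : vectType R) (g : {symmetric V}).
Implicit Types (f h : 'End(V)) (x y : V).

Lemma symmetricC x y : g x y = g y x.
Proof. by rewrite hermC expr0 mul1r. Qed.

Lemma symmetricDl x y z : g (x + y) z = g x z + g y z.
Proof. by rewrite linearDl. Qed.

Lemma symmetricNl x y : g (- x) y = - g x y.
Proof. by rewrite linearNl. Qed.

Lemma symmetricZl a x y : g (a *: x) y = a * g x y.
Proof. by rewrite linearZl_LR. Qed.

Lemma symmetricDr x y z : g z (x + y) = g z x + g z y.
Proof. by rewrite linearDr. Qed.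

Lemma symmetricNr x y : g y (- x) = - g y x.
Proof. by rewrite linearNr. Qed.

Lemma symmetricZr a x y : g y (a *: x) = a * g y x.
Proof. by rewrite linearZr_LR. Qed.

Lemma symmetric_suml I r (P : pred I) (E : I -> V) y :
  g (\sum_(i <- r | P i) E i) y = \sum_(i <- r | P i) g (E i) y.
Proof. exact: linear_sumlz. Qed.

Lemma symmetric_sumr I r (P : pred I) (E : I -> V) y :
  g y (\sum_(i <- r | P i) E i) = \sum_(i <- r | P i) g y (E i).
Proof. exact: linear_sumr. Qed.

Definition symmetricE := (symmetricDl, symmetricDr, symmetricNl, symmetricNr,
  symmetricZl, symmetricZr).

Definition self_adjoint f := forall x y, g (f x) y = g x (f y).

Lemma in_so_comp_self_adjoint f h : in_so g f -> self_adjoint h ->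
  (forall x, h (f x) = f (h x)) -> in_so g (h \o f)%VF.
Proof. by move=> fS hS hf x y; rewrite !comp_lfunE /= hS fS hf. Qed.

Lemma in_so_diag f x : in_so g f -> g (f x) x = 0.
Proof.
by move=> fS; have := fS x x; rewrite (symmetricC x (f x)) => eq; lra.
Qed.

Section Nondegenerate.
Hypothesis g_nd : nondegenerate g.

Lemma nondegenerate_eq0 x : (forall y, g x y = 0) -> x = 0.
Proof.
move=> gx0; apply/eqP; rewrite -memv0 -(eqP g_nd).
by apply/mem_orthovP => y _.
Qed.

Lemma nondegenerate_inj x y : (forall z, g x z = g y z) -> x = y.
Proof.
move=> gxy; apply/eqP; rewrite -subr_eq0; apply/eqP/nondegenerate_eq0 => z.
by rewrite symmetricDl symmetricNl gxy subrr.
Qed.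

(* In matrix terms M G = - G M^T for the invertible Gram matrix G, hence
   tr M = - tr M. *)
Lemma in_so_trace f : in_so g f -> lfun_trace f = 0.
Proof.
move=> fS; rewrite /lfun_trace; set M := lfun_mx f.
have eP := vbasisP {:V}; set e := vbasis {:V} in eP *.
pose G : 'M[R]_(\dim {:V}) := \matrix_(i, j) g e`_i e`_j.
have GE u (j : 'I__) : (u *m G) 0 j = g (vecof e u) e`_j.
  rewrite mxE /vecof symmetric_suml; apply: eq_bigr => i _.
  by rewrite mxE symmetricZl.
have G_unit : G \in unitmx.
  rewrite -row_free_unit -kermx_eq0; apply/rowV0P => u /sub_kermxP uG0.
  apply/eqP; rewrite -(vecof_eq0 eP); apply/eqP/nondegenerate_eq0 => y.
  rewrite (coord_basis eP (memvf y)) symmetric_sumr big1// => i _.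
  by rewrite symmetricZr -GE uG0 mxE mulr0.
have MG : M *m G = - (G *m M^T).
  apply/matrixP => i j; transitivity (g (f e`_i) e`_j).
    have := GE (row i M) j; rewrite -row_mul mxE => ->; congr (g _ _).
    by rewrite rowE mul_mxof (rVofK eP) vecof_delta.
  rewrite fS mxE; congr (- _); rewrite mxE symmetricC.
  have -> : f e`_j = vecof e (row j M).
    by rewrite rowE mul_mxof (rVofK eP) vecof_delta.
  rewrite /vecof symmetric_suml; apply: eq_bigr => k _.
  by rewrite symmetricZl !mxE symmetricC mulrC.
have : \tr M = - \tr M.
  rewrite -{1}[M](mulmxK G_unit) MG mulNmx linearN /= mxtrace_mulC mulKmx//.
  by rewrite mxtrace_tr.
by move=> eq; lra.
Qed.

End Nondegenerate.

(** * Lorentzian geometry: timelike and isotropic vectors *)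

Lemma lorentzian_timelike : lorentzian g ->
  exists2 t, g t t < 0 & forall x, g x t = 0 -> x != 0 -> 0 < g x x.
Proof.
case=> _ [e [eP ge]]; exists (tnth e ord0); first by rewrite ge eqxx /= ltrN10.
move=> x; have [c ->] : exists c : 'I_(1 + (\dim {:V}).-1) -> R,
    x = \sum_i c i *: e`_i.
  by exists (coord e ^~ x); exact: coord_basis eP (memvf x).
have gxj j : g (\sum_i c i *: e`_i) (tnth e j) =
    c j * (if (j < 1)%N then -1 else 1).
  rewrite symmetric_suml (bigD1 j)//= big1 => [|i ij].
    by rewrite addr0 symmetricZl -tnth_nth ge eqxx.
  by rewrite symmetricZl -tnth_nth ge (negPf ij) mulr0.
rewrite gxj mulrN1 => /eqP; rewrite oppr_eq0 => /eqP c0 x0.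
(* The coordinate along the timelike basis vector is zero, so the only minus sign of the form drops
   out. *)
have gxx : g (\sum_i c i *: e`_i) (\sum_i c i *: e`_i) = \sum_i c i ^+ 2.
  rewrite symmetric_sumr; apply: eq_bigr => j _; rewrite symmetricZr -tnth_nth gxj.
  case: ltnP => [|_]; last by rewrite mulr1.
  rewrite ltnS leqn0 => /eqP j0; suff -> : c j = 0 by rewrite !mul0r expr0n.
  by rewrite -c0; congr c; apply: val_inj.
rewrite gxx lt_def sumr_ge0 ?andbT => [|i _]; last exact: sqr_ge0.
apply: contra x0; rewrite psumr_eq0 => [/allP c20|i _]; last exact: sqr_ge0.
rewrite big1// => i _; have := c20 i (mem_index_enum _).
by rewrite /= sqrf_eq0 => /eqP ->; rewrite scale0r.
Qed.

Hypothesis g_lor : lorentzian g.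

(** The combination [z] of [x] and [t] is orthogonal to a reference timelike vector [t0], so [g z z]
    is positive unless [z = 0]. It is a positive multiple of [g x x] plus a nonpositive term, so
    [g x x] is positive too. If [z = 0], then [x] itself is orthogonal to [t0]. *)
Lemma timelike_complement t x : g t t < 0 -> g x t = 0 -> x != 0 -> 0 < g x x.
Proof.
have [t0 _ t0P] := lorentzian_timelike g_lor.
move=> tt xt x0; pose z := g t t0 *: x - g x t0 *: t.
have zt0 : g z t0 = 0 by rewrite /z !symmetricE; ring.
have gzz : g z z = g t t0 ^+ 2 * g x x + g x t0 ^+ 2 * g t t.
  by rewrite /z !symmetricE (symmetricC t x) xt; ring.
have tt0 : g t t0 != 0.
  apply/eqP => /t0P t_gt0; have: t != 0.
    by apply: contraTneq tt => ->; rewrite linear0l ltxx.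
  by move=> /t_gt0; lra.
have t2 : 0 < g t t0 ^+ 2 by rewrite lt_def sqrf_eq0 tt0 sqr_ge0.
have [z0|/(t0P _ zt0)] := eqVneq z 0; last first.
  rewrite gzz => gzz_gt0; have s2 : 0 <= g x t0 ^+ 2 by exact: sqr_ge0.
  by rewrite -(pmulr_rgt0 _ t2); nra.
have : g z t = - (g x t0 * g t t) by rewrite /z !symmetricE xt; ring.
rewrite z0 linear0l => /eqP; rewrite eq_sym oppr_eq0 mulf_eq0 (lt_eqF tt) orbF.
move=> /eqP xt0; have := t0P _ xt0 x0; exact.
Qed.

(** For a timelike [t], the combination [z] of [x] and [y] is isotropic and orthogonal to [t], hence
    zero. Its coefficient [g y t] at [x] is nonzero, because an isotropic [y != 0] cannot be
    orthogonal to [t]. *)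
Lemma isotropic_collinear x y : g x x = 0 -> g y y = 0 -> g x y = 0 ->
  y != 0 -> exists c, x = c *: y.
Proof.
have [t tt tP] := lorentzian_timelike g_lor.
move=> xx yy xy y0; pose z := g y t *: x - g x t *: y.
have zt : g z t = 0 by rewrite /z !symmetricE; ring.
have gzz : g z z = 0 by rewrite /z !symmetricE (symmetricC y x) xx yy xy; ring.
have z0 : z = 0.
  by apply/eqP; apply/negPn/negP => /(tP _ zt); rewrite gzz ltxx.
have yt : g y t != 0.
  by apply/eqP => /tP/(_ y0); rewrite yy ltxx.
exists (g x t / g y t); apply: (scalerI yt); rewrite scalerA mulrCA mulfV// mulr1.
by apply/eqP; rewrite -subr_eq0; apply/eqP.
Qed.

(** If [f x != 0], every [f y] is a multiple [c *: f x] by collinearity. Then [g y (f x) = - g (f y)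
    x = - c * g (f x) x = 0] for all [y], against nondegeneracy. *)
Lemma in_so_isotropic_image f : in_so g f ->
  (forall x y, g (f x) (f y) = 0) -> f = 0.
Proof.
move=> fS f_iso; apply/lfunP => x; rewrite zero_lfunE; apply/eqP.
apply/negPn/negP => fx0; move/eqP: (fx0); apply.
apply: (nondegenerate_eq0 (proj1 g_lor)) => y.
have [c fy] := isotropic_collinear (f_iso y y) (f_iso x x) (f_iso y x) fx0.
have := fS y x; rewrite fy symmetricZl (in_so_diag _ fS) mulr0.
by rewrite (symmetricC y) => eq; lra.
Qed.

(* The image of [h \o f] is isotropic: [g (h (f x)) (h (f y))] is
   [g (f x) (h (h (f y)))]. *)
Lemma self_adjoint_sqr_eq0 f h : in_so g f -> self_adjoint h ->
    (forall x, h (f x) = f (h x)) -> (forall x, h (h (f x)) = 0) ->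
  forall x, h (f x) = 0.
Proof.
move=> fS hS hf h2f x; suff : (h \o f)%VF = 0.
  by move=> /lfunP/(_ x); rewrite comp_lfunE zero_lfunE.
apply: in_so_isotropic_image => [|y z]; first exact: in_so_comp_self_adjoint.
by rewrite !comp_lfunE hS h2f linear0r.
Qed.

(** Since [g (h x) (h x) = - b ^+ 2 * g x x], one of [x], [h x] is timelike unless both are
    isotropic; in that case a combination of the two is. *)
Lemma complex_pair_timelike h x (b : R) : self_adjoint h -> b != 0 -> x != 0 ->
    h (h x) = - b ^+ 2 *: x ->
  exists2 t, g t t < 0 & h (h t) = - b ^+ 2 *: t.
Proof.
move=> hS b0 x0 hhx.
have b2 : 0 < b ^+ 2 by rewrite lt_def sqrf_eq0 b0 sqr_ge0.
have hxhx : g (h x) (h x) = - b ^+ 2 * g x x by rewrite hS hhx symmetricZr.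
have [xx|xx|xx] := ltgtP (g x x) 0; first by exists x.
  exists (h x); last by rewrite hhx linearZ.
  by rewrite hxhx mulNr oppr_lt0 mulr_gt0.
(* If isotropic [x] and [h x] were orthogonal, then [h x = c *: x] with [c ^+ 2 = - b ^+ 2], which
   is impossible. *)
have [xhx|xhx] := eqVneq (g x (h x)) 0.
  rewrite xx mulr0 in hxhx; rewrite symmetricC in xhx.
  have [c hx] := isotropic_collinear hxhx xx xhx x0.
  move: hhx; rewrite hx linearZ /= hx scalerA -expr2.
  move=> /eqP; rewrite -subr_eq0 -scalerBl scaler_eq0 (negPf x0) orbF.
  by have := sqr_ge0 c => c2 /eqP; lra.
(* The square of [x + d *: h x] is [2 * d * g x (h x)], which this [d] makes [-2]. *)
pose d := - (g x (h x))^-1.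
exists (x + d *: h x); last first.
  by rewrite addrC !linearP /= !hhx [h (_ *: x)]linearZ.
rewrite !symmetricE hxhx (symmetricC (h x)) xx /d.
suff : (g x (h x))^-1 * g x (h x) = 1 by nra.
by rewrite mulVf.
Qed.

Lemma in_so_timelike_eq0 f h t (b : R) : in_so g f -> self_adjoint h -> b != 0 ->
    (forall x, h (f x) = f (h x)) -> g t t < 0 -> h (h t) = - b ^+ 2 *: t ->
  f t = 0.
Proof.
move=> fS hS b0 hf tt hht; apply/eqP; apply/negPn/negP => ft0.
have ftt := in_so_diag t fS.
have hftt : g (h (f t)) t = 0.
  by have := in_so_diag t (in_so_comp_self_adjoint fS hS hf); rewrite comp_lfunE.
have ft_gt0 := timelike_complement tt ftt ft0.
have hft : g (h (f t)) (h (f t)) = - b ^+ 2 * g (f t) (f t).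
  by rewrite hS !hf hht [f (_ *: _)]linearZ symmetricZr.
have : 0 <= g (h (f t)) (h (f t)).
  have [->|/(timelike_complement tt hftt)/ltW//] := eqVneq (h (f t)) 0.
  by rewrite linear0l.
have b2 : 0 < b ^+ 2 by rewrite lt_def sqrf_eq0 b0 sqr_ge0.
by rewrite hft; nra.
Qed.

End SymmetricForms.

(** * Symmetries of the curvature tensor and of its Ricci operator *)

Section Curvature.
Variables (R : realType) (V : vectType R) (g : {symmetric V}).
Variables (K : {bilinear V -> V -> 'End(V)}) (Ric : 'End(V)).
Implicit Types (f h : 'End(V)) (x y u v : V).

Lemma lfun_traceC f h : lfun_trace (f \o h)%VF = lfun_trace (h \o f)%VF.
Proof.
by rewrite /lfun_trace /lfun_mx !(mxof_comp _ _ (vbasisP {:V})) mxtrace_mulC.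
Qed.

Lemma lfun_traceD f h : lfun_trace (f + h) = lfun_trace f + lfun_trace h.
Proof. by have := lfun_trace_linear 1 f h; rewrite !scale1r. Qed.

Lemma lfun_traceN f : lfun_trace (- f) = - lfun_trace f.
Proof. by rewrite /lfun_trace /lfun_mx !linearN. Qed.

Definition ricci_lfun u v : 'End(V) := linfun (fun a => K u a v).

Lemma ricci_lfunE u v a : ricci_lfun u v a = K u a v.
Proof.
have lK : linear (fun a => K u a v).
  by move=> c x y; rewrite linearPr add_lfunE scale_lfunE.
pose F : {linear V -> V} :=
  HB.pack (fun a => K u a v) (GRing.isLinear.Build _ _ _ _ _ lK).
exact: (lfunE F).
Qed.

Hypothesis g_lor : lorentzian g.
Hypothesis K_curv : curvature_tensor g K.
Hypothesis K_ss : semi_symmetric K.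
Hypothesis K_Ric : ricci_operator g K Ric.

Let g_nd : nondegenerate g := proj1 g_lor.

Lemma curvature_in_so u v : in_so g (K u v).
Proof. by case: K_curv. Qed.

Lemma curvatureC u v : K u v = - K v u.
Proof. by case: K_curv. Qed.

Lemma curvature_pair_symmetry u v x y : g (K u v x) y = g (K x y u) v.
Proof.
have [so asym bianchi] := K_curv.
have A a b c d : g (K a b c) d = - g (K b a c) d.
  by rewrite asym opp_lfunE symmetricNl.
have B a b c d : g (K a b c) d = - g (K a b d) c.
  by rewrite so symmetricC.
have C a b c d : g (K a b c) d + g (K b c a) d + g (K c a b) d = 0.
  by rewrite -!symmetricDl bianchi linear0l.
(* Octahedron argument: the Bianchi identities at the four cyclic shifts of [(u, v, x, y)], reduced
   to common terms by the antisymmetries [A] and [B], imply the claim linearly. *)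
have := C u v x y; have := C v x y u; have := C x y u v; have := C y u v x.
rewrite (B v x y u) (A v x u y) (B y v x u) (B x y v u) (A y u x v).
rewrite (B y u v x) (A y u x v) (B u v y x) (B v y u x) (A v y x u).
by move: (A v x y u) (A y v u x) (B y v u x) (A u x v y) (B u x v y)
   (B v x u y) (A x u v y) (B x u y v) (A y u x v) (B u y x v) (A v y u x)
   (B v y x u) (B x u v y) (A x u y v) => *; lra.
Qed.

Lemma curvature_eq0 x : (forall u v, K u v x = 0) -> forall y, K x y = 0.
Proof.
move=> Kx0 y; apply/lfunP => z; rewrite zero_lfunE.
apply: (nondegenerate_eq0 g_nd) => w.
by rewrite curvature_pair_symmetry Kx0 linear0l.
Qed.

Lemma ricci_operator_eq0 x : (forall u v, K u v x = 0) -> Ric x = 0.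
Proof.
move=> /curvature_eq0 Kx0; apply: (nondegenerate_eq0 g_nd) => v.
rewrite K_Ric /ricci -/(ricci_lfun x v).
suff -> : ricci_lfun x v = 0 by rewrite /lfun_trace /lfun_mx !linear0.
by apply/lfunP => a; rewrite ricci_lfunE Kx0 !zero_lfunE.
Qed.

(** By the Bianchi identity, the two endomorphisms being traced differ by [K u v], which is skew and
    so has trace zero. *)
Lemma ricciC u v : ricci K u v = ricci K v u.
Proof.
have [so _ bianchi] := K_curv.
apply/eqP; rewrite -subr_eq0 /ricci -!/(ricci_lfun _ _) -lfun_traceN -lfun_traceD.
apply/eqP/(in_so_trace g_nd).
suff -> : ricci_lfun u v - ricci_lfun v u = K u v by [].
apply/lfunP => a; rewrite add_lfunE opp_lfunE !ricci_lfunE.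
rewrite (curvatureC v a) (curvatureC u v) !opp_lfunE opprK.
by apply/eqP; rewrite -addr_eq0 bianchi.
Qed.

Lemma ricci_operator_self_adjoint : self_adjoint g Ric.
Proof. by move=> x y; rewrite (symmetricC g x) !K_Ric ricciC. Qed.

(* Semi-symmetry says that [K u v] is a derivation killing [K], so it also kills
   the trace of [K]. *)
Lemma ricci_operator_comm u v x : Ric (K u v x) = K u v (Ric x).
Proof.
set T := K u v; apply: (nondegenerate_inj g_nd) => y.
rewrite (curvature_in_so u v) !K_Ric.
apply/eqP; rewrite -subr_eq0 opprK; apply/eqP.
rewrite /ricci -!/(ricci_lfun _ _) -lfun_traceD.
have -> : ricci_lfun (T x) y + ricci_lfun x (T y) =
    (T \o ricci_lfun x y)%VF - (ricci_lfun x y \o T)%VF.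
  apply/lfunP => a; rewrite !(add_lfunE, opp_lfunE, comp_lfunE) !ricci_lfunE.
  have := K_ss u v x a => /lfunP/(_ y).
  rewrite !(add_lfunE, opp_lfunE, comp_lfunE) -/T => TK.
  by rewrite -[T (K x a y)](subrK (K x a (T y))) TK addrAC addrK.
by rewrite lfun_traceD lfun_traceN lfun_traceC subrr.
Qed.

Lemma self_adjoint_shift_prod s x y :
  g (shift_prod Ric s x) y = g x (shift_prod Ric s y).
Proof.
elim: s x y => //= a s IH x y.
rewrite symmetricDl symmetricNl symmetricZl ricci_operator_self_adjoint !IH.
rewrite (shift_prod_comm s y (fun=> erefl)) symmetricDr symmetricNr symmetricZr.
by [].
Qed.

(** * Reality of the eigenvalues of the Ricci operator *)

Lemma complex_eigenvalue_pair f (z : R[i]) : complex_eigenvalue f z ->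
    z \isn't Num.real ->
  exists a b x, [/\ b != 0, x != 0 &
    f (f x - a *: x) - a *: (f x - a *: x) = - b ^+ 2 *: x].
Proof.
case: z => a b /eigenvalueP[v vz v0]; rewrite complex_real => b0.
have eP := vbasisP {:V}.
pose re := \row_j complex.Re (v 0 j); pose im := \row_j complex.Im (v 0 j).
have vE i j : (v *m map_mx (real_complex R) (lfun_mx f)) i j =
  ((re *m lfun_mx f) i j +i* (im *m lfun_mx f) i j)%C.
  rewrite !mxE; elim/big_rec3: _ => //= k c1 c2 c3 _ ->.
  rewrite !mxE (ord1 i); case: (v 0 k) => p q /=.
  by congr (_ +i* _)%C; ring.
(* Real and imaginary parts of the eigenvector equation: [f - a] sends [x] to [- b *: y] and [y] to
   [b *: x], so its square is [- b ^+ 2] on both, and at least one of them is nonzero. *)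
have reE : re *m lfun_mx f = a *: re - b *: im.
  apply/rowP => j; have := vE 0 j; rewrite vz !mxE.
  by case: (v 0 j) => p q [].
have imE : im *m lfun_mx f = a *: im + b *: re.
  apply/rowP => j; have := vE 0 j; rewrite vz !mxE.
  by case: (v 0 j) => p q [].
pose x := vecof (vbasis {:V}) re; pose y := vecof (vbasis {:V}) im.
have fx : f x - a *: x = - b *: y.
  rewrite -[f x](rVofK eP) -mul_mxof -/(lfun_mx f) reE linearB !linearZ /= -/x -/y.
  by rewrite !scalerN addrAC subrr add0r scaleNr.
have fy : f y - a *: y = b *: x.
  rewrite -[f y](rVofK eP) -mul_mxof -/(lfun_mx f) imE linearD !linearZ /= -/x -/y.
  by rewrite scalerN addrAC subrr add0r.
have scale c w : f (c *: w) - a *: (c *: w) = c *: (f w - a *: w).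
  by rewrite linearZ scalerBr !scalerA mulrC.
have [x0|x0] := eqVneq x 0; last first.
  by exists a, b, x; rewrite fx scale fy scalerA mulNr.
exists a, b, y; rewrite fy scale fx scalerA mulrN; split => //.
apply: contra v0 => /eqP y0; apply/eqP/rowP => j; rewrite mxE.
have /rowP/(_ j) : re = 0 by apply/eqP; rewrite -(vecof_eq0 eP) -/x x0.
have /rowP/(_ j) : im = 0 by apply/eqP; rewrite -(vecof_eq0 eP) -/y y0.
by rewrite !mxE; case: (v 0 j) => p q /= -> ->.
Qed.

Lemma ricci_eigenvalue_real (z : R[i]) :
  complex_eigenvalue Ric z -> z \is Num.real.
Proof.
move=> Rz; apply/negPn/negP => /(complex_eigenvalue_pair Rz)[a [b [x []]]].
move=> b0 x0 DDx; pose D := Ric - a *: \1%VF.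
have DE y : D y = Ric y - a *: y.
  by rewrite add_lfunE opp_lfunE scale_lfunE id_lfunE.
have D_sa : self_adjoint g D.
  move=> y w; rewrite !DE !symmetricE ricci_operator_self_adjoint.
  by [].
rewrite -!DE in DDx.
have [t tt DDt] := complex_pair_timelike g_lor D_sa b0 x0 DDx.
have Rt : Ric t = 0.
  apply: ricci_operator_eq0 => u v.
  apply: (in_so_timelike_eq0 g_lor (curvature_in_so u v) D_sa b0 _ tt DDt) => y.
  by rewrite !DE ricci_operator_comm linearB /= [K u v (_ *: _)]linearZ.
(* On [t] the operator [D] is the scalar [- a], so [a ^+ 2 = - b ^+ 2], which contradicts
   [b != 0]. *)
have Dt : D t = - a *: t by rewrite DE Rt sub0r scaleNr.
have t0 : t != 0 by apply: contraTneq tt => ->; rewrite linear0l ltxx.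
move: DDt; rewrite Dt linearZ /= Dt scalerA => /eqP.
rewrite -subr_eq0 -scalerBl scaler_eq0 (negPf t0) orbF.
have b2 : 0 < b ^+ 2 by rewrite lt_def sqrf_eq0 b0 sqr_ge0.
by move=> /eqP; have := sqr_ge0 a; nra.
Qed.

(** * Split polynomials annihilating the curvature, and the resulting decomposition *)

Lemma char_poly_ricci_split : exists s : seq R,
  char_poly (lfun_mx Ric) = \prod_(a <- s) ('X - a%:P).
Proof.
set M := lfun_mx Ric; set MC := map_mx (real_complex R) M.
have [s] := closed_field_poly_normal (char_poly MC).
rewrite (monicP (char_poly_monic _)) scale1r => MCs.
exists (map (@complex.Re R) s).
(* The complex factorisation has only real roots, so it descends along the injection of real
   polynomials into complex ones. *)
apply: (map_poly_inj (real_complex R)); rewrite map_char_poly map_prod_XsubC /=.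
rewrite -/MC MCs big_map; apply: eq_big_seq => z zs.
suff /ricci_eigenvalue_real : complex_eigenvalue Ric z.
  by case: z {zs} => a b; rewrite complex_real => /eqP ->.
by rewrite /complex_eigenvalue eigenvalue_root_char MCs root_prod_XsubC.
Qed.

(* A repeated root can be dropped: if [s] contains [a] twice, then the product
   with one [a] removed squares to zero on the images of [K]. *)
Lemma shift_prod_curvature_undup s t :
    (forall u v x, shift_prod Ric (s ++ t) (K u v x) = 0) ->
  forall u v x, shift_prod Ric (undup s ++ t) (K u v x) = 0.
Proof.
(* The suffix [t] varies in the induction: it collects the roots kept so far. *)
elim: s t => //= a s IH t st0; case: ifPn => [as_|aNs]; last first.
  have perm s' : perm_eq (s' ++ a :: t) ((a :: s') ++ t).
    by rewrite -cat1s perm_catCA.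
  move=> u v x; rewrite -(perm_shift_prod _ _ (perm _)).
  apply: IH => {}u {}v {}x; rewrite (perm_shift_prod _ _ (perm _)).
  exact: st0.
apply: IH => u v x.
have s1E := perm_to_rem as_; set s1 := rem a s in s1E.
have E w : shift_prod Ric (s ++ t) w = shift_prod Ric (a :: s1 ++ t) w.
  by apply: perm_shift_prod; rewrite -cat_cons perm_cat2r.
rewrite E; pose h : 'End(V) := linfun (shift_prod Ric (a :: s1 ++ t)).
have hE w : h w = shift_prod Ric (a :: s1 ++ t) w by rewrite lfunE.
rewrite -hE; apply: (self_adjoint_sqr_eq0 g_lor (curvature_in_so u v)).
- by move=> y w; rewrite !hE self_adjoint_shift_prod.
- by move=> y; rewrite !hE shift_prod_comm// => w; rewrite ricci_operator_comm.
(* In the square of [h], the [a] of the outer factor moves next to the inner one; up to order,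
   [a :: a :: s1 ++ t] is [a :: s ++ t], which kills the images of [K]. *)
move=> y; rewrite !hE -cat1s shift_prod_cat shift_prod_catC.
set h' := shift_prod Ric (a :: s1 ++ t).
by rewrite -[shift_prod Ric [:: a] _]/(Ric (h' _) - _) /h' -E st0 shift_prod0.
Qed.

Lemma ricci_operator_decomp : exists s : seq R,
  0 \notin s /\
  forall x, x \in (lker (Ric \o Ric) + \sum_(a <- s) leigenspace Ric a)%VS.
Proof.
have [s /shift_prod_char_poly s0] := char_poly_ricci_split.
(* Prepending [0] ensures that a factor [Ric] can be split off, whether or not [0] is an
   eigenvalue. *)
pose s' := undup (0 :: s); exists (rem 0 s').
have s'_uniq : uniq s' by exact: undup_uniq.
have zs' : 0 \in s' by rewrite mem_undup mem_head.
have zNs : 0 \notin rem 0 s' by rewrite mem_rem_uniqF.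
split=> // x; apply: shift_prod_ker_decomp => //; first exact: rem_uniq.
have K0 u v y : shift_prod Ric s' (K u v y) = 0.
  rewrite -[s']cats0; apply: shift_prod_curvature_undup => {}u {}v {}y.
  by rewrite cats0 /= s0 linear0 scaler0 subrr.
(* Every [K u v] kills the value of the product at [x], hence so does [Ric]. Together with the
   factor [Ric] in the product itself, this produces the square in the definition of [V_0]. *)
have : Ric (shift_prod Ric s' x) = 0.
  apply: ricci_operator_eq0 => u v; rewrite -shift_prod_comm ?K0// => y.
  by rewrite ricci_operator_comm.
rewrite (perm_shift_prod _ _ (perm_to_rem zs')) /= scale0r subr0 => RR0.
by rewrite memv_ker comp_lfunE RR0.
Qed.

(** * The spaces [V_0], ..., [V_r]: orthogonality, invariance and dimension *)

Section EigenspaceSplitting.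
Variables (r : nat) (alpha : r.-tuple R).
Hypothesis alphaP : enumerates_nonzero_eigenvalues Ric alpha.

Let W := ker2_eigenspace Ric alpha.

Lemma ker2_eigenspace0 : W ord0 = lker (Ric \o Ric).
Proof. by rewrite /W /ker2_eigenspace unlift_none. Qed.

Lemma ker2_eigenspace_lift j : W (lift ord0 j) = leigenspace Ric (tnth alpha j).
Proof. by rewrite /W /ker2_eigenspace liftK. Qed.

Lemma ker2_eigenspace_full : (\sum_i W i)%VS = fullv.
Proof.
have [s [zs sP]] := ricci_operator_decomp.
apply/eqP; rewrite eqEsubv subvf; apply/subvP => x _.
have := sP x; apply/subvP; rewrite subv_add.
rewrite -ker2_eigenspace0 (sumv_sup ord0)//=.
elim: s zs {sP} => [|a s IH]; first by rewrite big_nil sub0v.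
rewrite in_cons negb_or eq_sym big_cons subv_add => /andP[a0 /IH ->].
(* Entries of [s] that are not eigenvalues contribute the zero space; the others occur in
   [alpha]. *)
rewrite andbT; have [->|Ea] := eqVneq (leigenspace Ric a) 0%VS.
  exact: sub0v.
have /tnthP[j aj] : a \in alpha by rewrite alphaP.2 a0.
by rewrite (sumv_sup (lift ord0 j))// ker2_eigenspace_lift -aj.
Qed.

Lemma leigenspace_orthogonal a b x y : a != b ->
  x \in leigenspace Ric a -> y \in leigenspace Ric b -> g x y = 0.
Proof.
rewrite !mem_leigenspace -subr_eq0 => ab /eqP xa /eqP yb.
have := ricci_operator_self_adjoint x y; rewrite xa yb !symmetricE => eq.
by apply: (mulfI ab); rewrite mulr0 mulrBl eq subrr.
Qed.

Lemma leigenspace_ker2_orthogonal a x y : a != 0 ->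
  x \in leigenspace Ric a -> y \in lker (Ric \o Ric) -> g x y = 0.
Proof.
rewrite mem_leigenspace memv_ker comp_lfunE => a0 /eqP xa /eqP RRy.
have : g (Ric (Ric x)) y = 0 by rewrite !ricci_operator_self_adjoint RRy linear0r.
rewrite xa linearZ /= xa !symmetricZl => /eqP.
by rewrite !mulf_eq0 (negPf a0) => /eqP.
Qed.

Lemma tnth_eigenvalue_neq0 j : tnth alpha j != 0.
Proof. by have := mem_tnth j alpha; rewrite alphaP.2 => /andP[]. Qed.

Lemma ker2_eigenspace_orthogonal i j x y : i != j ->
  x \in W i -> y \in W j -> g x y = 0.
Proof.
case: (unliftP ord0 i) (unliftP ord0 j) => [i' ->|->] [j' ->|->] //.
- rewrite (inj_eq lift_inj) !ker2_eigenspace_lift => ij.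
  apply: leigenspace_orthogonal; apply: contra ij => /eqP ij.
  by apply/eqP/(tuple_uniqP _ alphaP.1).
- rewrite ker2_eigenspace0 ker2_eigenspace_lift => _.
  exact/leigenspace_ker2_orthogonal/tnth_eigenvalue_neq0.
- rewrite ker2_eigenspace0 ker2_eigenspace_lift symmetricC => _ xW yW.
  exact: (leigenspace_ker2_orthogonal (tnth_eigenvalue_neq0 j')).
Qed.

Lemma ker2_eigenspace_stable u v i x : x \in W i -> K u v x \in W i.
Proof.
case: (unliftP ord0 i) => [i' ->|->].
  rewrite ker2_eigenspace_lift !mem_leigenspace => /eqP xi.
  by rewrite ricci_operator_comm xi linearZ.
rewrite ker2_eigenspace0 !memv_ker !comp_lfunE => /eqP RRx.
by rewrite !ricci_operator_comm RRx linear0.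
Qed.

(** By pair symmetry [g (K u v x) y = g (K x y u) v], and [K x y u] stays in [W i], which is
    orthogonal to [W j]. *)
Lemma ker2_eigenspace_curvature i j u v : i != j ->
  u \in W i -> v \in W j -> K u v = 0.
Proof.
move=> ij ui vj; apply/lfunP => x; rewrite zero_lfunE.
apply: (nondegenerate_eq0 g_nd) => y; rewrite curvature_pair_symmetry.
exact: (ker2_eigenspace_orthogonal ij (ker2_eigenspace_stable _ _ ui)).
Qed.

(** A vector of [W i] that is also in the sum of the others is orthogonal to each [W j]: for
    [j != i] by the first membership, for [j = i] by the second. These spaces span, so nondegeneracy
    makes it zero. *)
Lemma ker2_eigenspace_direct : directv (\sum_i W i).
Proof.
apply/directv_sumP => i _; apply/eqP; rewrite -subv0; apply/subvP => x.
rewrite memv_cap memv0 => /andP[xi xNi]; apply/eqP/(nondegenerate_eq0 g_nd) => y.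
have := memvf y; rewrite -ker2_eigenspace_full => /memv_sumP[ys yW ->].
rewrite symmetric_sumr big1// => j _; have [ij|ij] := eqVneq i j; last first.
  exact: (ker2_eigenspace_orthogonal ij xi (yW j isT)).
move/memv_sumP: xNi => [xs xW ->]; rewrite symmetric_suml big1// => k ki.
by apply: (ker2_eigenspace_orthogonal _ (xW k ki) (yW j isT)); rewrite -ij.
Qed.

(* On a one-dimensional eigenspace [K u v] vanishes for [u], [v] proportional,
   so [K u] would vanish identically. *)
Lemma ker2_eigenspace_dim i : i != ord0 -> (2 <= \dim (W i))%N.
Proof.
move=> i0; rewrite leqNgt; apply/negP; rewrite ltnS => W1.
have [j ij] : exists j, i = lift ord0 j.
  by case: (unliftP ord0 i) i0 => [j -> _|->]; [exists j|rewrite eqxx].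
have := mem_tnth j alpha; rewrite alphaP.2 => /andP[a0].
rewrite /leigenvalue -ker2_eigenspace_lift -ij => Wi0.
have x0 := Wi0; rewrite -vpick0 in x0; set x := vpick _ in x0.
have xW : x \in W i by exact: memv_pick.
have WE : W i = <[x]>%VS.
  apply/esym/eqP; rewrite eqEdim -memvE xW /= (leq_trans W1)//.
  by rewrite dim_vline x0.
have Kx y : K x y = 0.
  have := memvf y; rewrite -ker2_eigenspace_full => /memv_sumP[ys yW ->].
  rewrite linear_sumr big1// => k _; have [ik|ik] := eqVneq i k; last first.
    exact: (ker2_eigenspace_curvature ik xW (yW k isT)).
  have := yW k isT; rewrite -ik WE => /vlineP[c ->].
  rewrite linearZr_LR; suff -> : K x x = 0 by rewrite scaler0.
  have /eqP := curvatureC x x; rewrite -addr_eq0 -mulr2n -scaler_nat.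
  by rewrite scaler_eq0 pnatr_eq0 => /eqP.
(* Pair symmetry turns the vanishing of [K x] into that of every [K u v x]; then [Ric x = 0]
   contradicts the nonzero eigenvalue. *)
have Rx : Ric x = 0.
  apply: ricci_operator_eq0 => u v; apply: (nondegenerate_eq0 g_nd) => w.
  by rewrite curvature_pair_symmetry Kx zero_lfunE linear0l.
move: xW; rewrite ij ker2_eigenspace_lift mem_leigenspace Rx eq_sym.
by rewrite scaler_eq0 (negPf a0) (negPf x0).
Qed.

End EigenspaceSplitting.
End Curvature.

(** * Passage from statements about vectors to inclusions of subspaces *)

Theorem proposition2p6 (R : realType) (V : vectType R) (g : {symmetric V})
    (K : {bilinear V -> V -> 'End(V)}) (Ric : 'End(V)) :
  (3 <= \dim {:V})%N ->
  lorentzian g ->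
  curvature_tensor g K ->
  semi_symmetric K ->
  ricci_operator g K Ric ->
  (forall z : R[i], complex_eigenvalue Ric z -> z \is Num.real) /\
  forall (r : nat) (alpha : r.-tuple R),
    enumerates_nonzero_eigenvalues Ric alpha ->
    let W := ker2_eigenspace Ric alpha in
    [/\ [/\ (\sum_i W i)%VS = fullv,
            directv (\sum_i W i)
          & forall i j, i != j -> (W i <= orthov g (W j))%VS],
        forall u v i, (K u v @: W i <= W i)%VS,
        forall i j, i != j ->
          forall u v, u \in W i -> v \in W j -> K u v = 0
      & forall i, i != ord0 -> (2 <= \dim (W i))%N].
Proof.
move=> _ g_lor K_curv K_ss K_Ric; split=> [z|r alpha alphaP W].
  exact: (ricci_eigenvalue_real g_lor K_curv K_ss K_Ric).
split.
- split.
  + exact: (ker2_eigenspace_full g_lor K_curv K_ss K_Ric alphaP).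
  + exact: (ker2_eigenspace_direct g_lor K_curv K_ss K_Ric alphaP).
  + move=> i j ij; apply/orthovP => x y.
    exact: (ker2_eigenspace_orthogonal g_lor K_curv K_Ric alphaP ij).
- move=> u v i; apply/subvP => _ /memv_imgP[x xW ->].
  exact: (ker2_eigenspace_stable g_lor K_curv K_ss K_Ric).
- move=> i j ij u v.
  exact: (ker2_eigenspace_curvature g_lor K_curv K_ss K_Ric alphaP ij).
- by move=> i; apply: (ker2_eigenspace_dim g_lor K_curv K_ss K_Ric alphaP).
Qed.
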